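(* Let $F$ be an algebraically closed field. Assume that the Nagata--Iarrobino conjecture holds over $F$, i.e. assume that for all integers $n\ge 1$ and $s\ge\max\{n+7,2^n\}$, the homogeneous ideal $I\subseteq F[x_0,\ldots,x_n]$ of $s$ very general points in $\mathbb{P}^n$ over $F$ satisfies $\widehat{\alpha}(I)\ge\sqrt[n]{s}$. Then for all integers $n\ge 1$ and $s\ge\max\{n+7,2^n\}$, the homogeneous ideal $I\subseteq F[x_0,\ldots,x_n]$ of $s$ very general points in $\mathbb{P}^n$ over $F$ satisfies $$\widehat{\alpha}(I)\ge\frac{\alpha(I^{(m)})+n-1}{m+n-1}\quad\text{for all integers } m\ge 1.$$
   Context: For a nonzero homogeneous ideal $J\subseteq F[x_0,\ldots,x_n]$, $\alpha(J)=\min\{\deg f\mid f \text{ is a nonzero homogeneous polynomial in } J\}$. If $I$ is the homogeneous ideal of the finite set of points $\{p_1,\ldots,p_s\}\subset\mathbb{P}^n$, then for an integer $m\ge 1$ the $m$-th symbolic power $I^{(m)}$ is the ideal generated by all homogeneous polynomials $f\in F[x_0,\ldots,x_n]$ that vanish to order at least $m$ at each $p_i$. The Waldschmidt constant of $I$ is $\widehat{\alpha}(I)=\inf_{m\ge 1}\frac{\alpha(I^{(m)})}{m}$, which equals $\lim_{m\to\infty}\frac{\alpha(I^{(m)})}{m}$. A statement holds for $s$ very general points in $\mathbb{P}^n$ if there are countably many proper Zariski closed subsets of $(\mathbb{P}^n)^s$ such that the statement holds for every set $\{p_1,\ldots,p_s\}$ of $s$ distinct points for which $(p_1,\ldots,p_s)$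 lies outside the union of these closed subsets. *)

(* Defs.v *)
From HB Require Import structures.
From mathcomp Require Import all_boot all_order all_algebra.
From mathcomp Require Import boolp classical_sets reals exp.
From mathcomp Require Import mpoly.

Set Implicit Arguments.
Unset Strict Implicit.
Unset Printing Implicit Defensive.

Import Order.TTheory GRing.Theory Num.Theory.
Local Open Scope classical_set_scope.
Local Open Scope ring_scope.

(* The points of P^n over F are the lines through the origin of F^(n+1). *)
Definition proj_point (F : fieldType) (n : nat) : Type :=
  {L : {vspace 'rV[F]_n.+1} | \dim L == 1%N}.

Definition is_representative (F : fieldType) (n : nat)
    (P : proj_point F n) (v : 'rV[F]_n.+1) : Prop :=
  v \in val P /\ v != 0.

(* The variable of index (mxvec_index i j) is the j-th homogeneous coordinate
   of the i-th factor of (P^n)^s. *)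
Definition multihomogeneous (F : fieldType) (n s : nat)
    (G : {mpoly F[s * n.+1]}) : Prop :=
  exists d : 'I_s -> nat, forall mu, mu \in msupp G ->
    forall i, (\sum_(j < n.+1) mu (mxvec_index i j) = d i)%N.

Definition multi_zero (F : fieldType) (n s : nat)
    (G : {mpoly F[s * n.+1]}) (p : 'I_s -> proj_point F n) : Prop :=
  forall V : 'M[F]_(s, n.+1),
    (forall i, is_representative (p i) (row i V)) ->
    G.@[fun k => mxvec V 0 k] = 0.

Definition zariski_closed (F : fieldType) (n s : nat)
    (Z : set ('I_s -> proj_point F n)) : Prop :=
  exists S : set {mpoly F[s * n.+1]},
    (forall G, S G -> multihomogeneous G) /\
    Z = [set p | forall G, S G -> multi_zero G p].

(* A finite family of closed sets is covered too, padded with the empty set. *)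
Definition for_very_general (F : fieldType) (n s : nat)
    (Q : ('I_s -> proj_point F n) -> Prop) : Prop :=
  exists Z : nat -> set ('I_s -> proj_point F n),
    (forall k, zariski_closed (Z k) /\ Z k <> setT) /\
    (forall p, injective p -> ~ (\bigcup_k Z k) p -> Q p).

(* The coefficients of the Taylor expansion f(v + X) are the Hasse derivatives
   of f at v, so that the notion is correct in every characteristic; when f is
   homogeneous it does not depend on the representative v. *)
Definition vanishes_to_order (F : fieldType) (n m : nat)
    (f : {mpoly F[n.+1]}) (P : proj_point F n) : Prop :=
  forall v, is_representative P v -> forall mu : 'X_{1..n.+1},
    (mdeg mu < m)%N ->
    (f \mPo [tuple 'X_i + (v 0 i)%:MP | i < n.+1])@_mu = 0.

Definition ideal_generated (A : nzRingType) (S : set A) : set A :=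
  [set f | exists k (a g : 'I_k -> A),
     (forall i, S (g i)) /\ f = \sum_(i < k) a i * g i].

Definition symbolic_power (F : fieldType) (n s : nat)
    (p : 'I_s -> proj_point F n) (m : nat) : set {mpoly F[n.+1]} :=
  ideal_generated
    [set f | (exists d, f \is d.-homog) /\
             forall i, vanishes_to_order m f (p i)].

Definition has_form_of_degree (F : fieldType) (n : nat)
    (J : set {mpoly F[n.+1]}) (d : nat) : Prop :=
  exists f, [/\ J f, f != 0 & f \is d.-homog].

(* The default value 0 is only returned when J has no nonzero homogeneous
   element; symbolic powers of ideals of points are nonzero. *)
Definition alpha (F : fieldType) (n : nat) (J : set {mpoly F[n.+1]}) : nat :=
  xget 0%N [set d | has_form_of_degree J d /\
                    forall e, has_form_of_degree J e -> (d <= e)%N].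

Definition waldschmidt (R : realType) (F : fieldType) (n s : nat)
    (p : 'I_s -> proj_point F n) : R :=
  inf [set (alpha (symbolic_power p m))%:R / m%:R | m in [set m | (1 <= m)%N]].

Definition Nagata_Iarrobino (R : realType) (F : fieldType) : Prop :=
  forall n s : nat, (1 <= n)%N -> (maxn (n + 7) (2 ^ n) <= s)%N ->
    @for_very_general F n s (fun p =>
      (s%:R : R) `^ (n%:R^-1) <= waldschmidt R p).

(* Main.v *)
(* With alpha = alpha(I^(m)), it suffices to bound (alpha + n - 1) / (m + n - 1)
   by the n-th root of s, for arbitrary points. Vanishing to order m at a point
   imposes at most C(m+n-1, n) linear conditions on forms of a given degree, so
   the absence of forms of degree alpha - 1 in I^(m) gives
     alpha (alpha+1) ... (alpha+n-1) <= s m (m+1) ... (m+n-1).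
   If alpha >= m, then each (alpha+n-1)/(alpha+k) is at most (m+n-1)/(m+k), hence
   (alpha+n-1)^n <= s (m+n-1)^n; if alpha < m, the ratio is less than 1. *)

From HB Require Import structures.
Require Import Defs.
From mathcomp Require Import all_boot all_order all_algebra.
From mathcomp Require Import boolp classical_sets reals exp.
From mathcomp Require Import mpoly.
From mathcomp Require Import zify ring.

Set Implicit Arguments.
Unset Strict Implicit.
Unset Printing Implicit Defensive.

Import Order.TTheory GRing.Theory Num.Theory.
Local Open Scope ring_scope.

(** * Arithmetic: from binomial coefficients to n-th roots *)

Lemma expn_ffact_le (a b k : nat) : (b <= a)%N ->
  (a ^ k * b ^_ k <= b ^ k * a ^_ k)%N.
Proof.
move=> le_ba; elim: k => [|k IHk]; first by rewrite !ffactn0.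
rewrite !ffactnSr !expnSr.
(* The comparison is factorwise; truncated subtraction makes the left side 0 when [b < k]. *)
have le_step : (a * (b - k) <= b * (a - k))%N.
  by rewrite !mulnBr [(b * a)%N]mulnC leq_sub2l // leq_mul2r le_ba orbT.
by rewrite mulnACA [leqRHS]mulnACA leq_mul.
Qed.

(** Multiplying the binomials by n! turns them into falling factorials, which [expn_ffact_le]
    exchanges for powers. *)
Lemma bin_le_expn (n s a b : nat) : (b <= a)%N ->
  ('C(a + n, n) <= s * 'C(b + n, n))%N -> ((a + n) ^ n <= s * (b + n) ^ n)%N.
Proof.
move=> le_ba le_bin.
have ffact_gt0n : (0 < (b + n) ^_ n)%N by rewrite ffact_gt0 leq_addl.
rewrite -(leq_pmul2r ffact_gt0n) (leq_trans (expn_ffact_le _ _)) ?leq_add2r //.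
rewrite -mulnA [leqRHS]mulnCA leq_mul2l -!bin_ffact mulnA leq_mul2r le_bin.
by rewrite !orbT.
Qed.

Lemma ratio_le_root (R : realType) (n s a b : nat) : (0 < n)%N ->
  (a ^ n <= s * b ^ n)%N -> (a%:R / b%:R : R) <= s%:R `^ n%:R^-1.
Proof.
move=> n_gt0 le_ab.
have [->|b_gt0] := posnP b; first by rewrite invr0 mulr0 powR_ge0.
have n_neq0 : n%:R != 0 :> R by rewrite pnatr_eq0 -lt0n.
have ratio_ge0 : 0 <= a%:R / b%:R :> R by rewrite divr_ge0.
(* The ratio x is rewritten as (x^n)^(1/n), so that monotonicity of the n-th root applies. *)
rewrite -[leLHS](powRr1 ratio_ge0) -[X in _ `^ X <= _](mulfV n_neq0) powRrM.
rewrite powR_mulrn //.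
apply: (@ge0_ler_powR _ n%:R^-1); rewrite ?nnegrE ?invr_ge0 ?exprn_ge0 //.
rewrite expr_div_n ler_pdivrMr ?exprn_gt0 ?ltr0n //.
by rewrite -!natrX -natrM ler_nat.
Qed.

(** * Order of vanishing at the origin *)

Section Order.
Context (n : nat) (F : comNzRingType).
Implicit Types f g : {mpoly F[n]}.

(** [vanishes_to_order] is this property for the translates of a polynomial by the representatives
    of a point. *)
Definition order_ge (m : nat) f := forall mu, (mdeg mu < m)%N -> f@_mu = 0.

Lemma order_ge0 f : order_ge 0 f. Proof. by []. Qed.

Lemma order_geZ m c f : order_ge m f -> order_ge m (c *: f).
Proof. by move=> ord_f mu lt_mu; rewrite mcoeffZ ord_f ?mulr0. Qed.

Lemma order_ge_sum (I : Type) (r : seq I) (P : pred I) m (f : I -> {mpoly F[n]}) :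
  (forall i, P i -> order_ge m (f i)) -> order_ge m (\sum_(i <- r | P i) f i).
Proof.
by move=> ord_f mu lt_mu; rewrite raddf_sum big1 //= => i Pi; apply: ord_f.
Qed.

Lemma order_geM a b f g :
  order_ge a f -> order_ge b g -> order_ge (a + b) (f * g).
Proof.
move=> ord_f ord_g mu lt_mu; rewrite mcoeffM big1 // => -[k1 k2] /= /eqP mu_eq.
have [lt_k1|le_k1] := ltnP (mdeg k1) a; first by rewrite ord_f ?mul0r.
rewrite ord_g ?mulr0 //.
by have := congr1 mdeg mu_eq; rewrite mdegD; lia.
Qed.

Lemma order_geX a k f : order_ge a f -> order_ge (k * a) (f ^+ k).
Proof.
move=> ord_f; elim: k => [|k IHk]; first exact: order_ge0.
by rewrite exprS mulSn; apply: order_geM.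
Qed.

Lemma order_ge_prod (I : Type) (r : seq I) (a : I -> nat) (f : I -> {mpoly F[n]}) :
  (forall i, order_ge (a i) (f i)) ->
  order_ge (\sum_(i <- r) a i)%N (\prod_(i <- r) f i).
Proof.
move=> ord_f; elim: r => [|i r IHr]; first by rewrite !big_nil; apply: order_ge0.
by rewrite !big_cons; apply: order_geM.
Qed.

End Order.

(** * Linear changes of coordinates *)

Lemma comp_mpolyA (F : comNzRingType) (n k l : nat) (f : {mpoly F[n]})
    (lq : n.-tuple {mpoly F[k]}) (lr : k.-tuple {mpoly F[l]}) :
  (f \mPo lq) \mPo lr = f \mPo [tuple tnth lq i \mPo lr | i < n].
Proof.
rewrite [f \mPo lq]comp_mpolyEX [RHS]comp_mpolyEX raddf_sum; apply: eq_bigr => mu _ /=.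
rewrite comp_mpolyZ !comp_mpolyX rmorph_prod; congr (_ *: _).
by apply: eq_bigr => i _; rewrite rmorphXn tnth_mktuple.
Qed.

Lemma dhomog_comp (F : comNzRingType) (n k e : nat) (f : {mpoly F[n]})
    (lq : n.-tuple {mpoly F[k]}) :
  (forall i, tnth lq i \is 1.-homog) -> f \is e.-homog -> f \mPo lq \is e.-homog.
Proof.
move=> homog_lq /dhomogP homog_f; rewrite comp_mpolyE big_seq.
apply: rpred_sum => mu /homog_f /= <-; apply: rpredZ; rewrite /= mdegE.
elim/big_rec2: _ => [|i a b _ homog_b]; first exact: dhomog1.
apply: dhomogM => //.
by have := dhomogMn (mu i) (homog_lq i); rewrite mul1n.
Qed.

Section Shear.
Context (F : comNzRingType) (n : nat) (i0 : 'I_n).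
Implicit Type c : 'I_n -> F.

Definition shear c : n.-tuple {mpoly F[n]} :=
  [tuple 'X_j + c j *: 'X_i0 | j < n].

Lemma shear_homog c j : tnth (shear c) j \is 1.-homog.
Proof.
by rewrite tnth_mktuple rpredD ?rpredZ // dhomogX /= mdeg1.
Qed.

(** Since [c i0 = 0], both substitutions fix ['X_i0], so the added multiples of it cancel. *)
Lemma shearK c (f : {mpoly F[n]}) : c i0 = 0 ->
  (f \mPo shear c) \mPo shear (fun j => - c j) = f.
Proof.
move=> ci0; rewrite comp_mpolyA -[RHS]comp_mpoly_id; congr comp_mpoly.
apply: eq_from_tnth => j; rewrite !tnth_mktuple comp_mpolyD comp_mpolyZ.
rewrite !comp_mpolyXU -!tnth_nth !tnth_mktuple ci0 oppr0 scale0r addr0.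
by rewrite scaleNr subrK.
Qed.

(* The shear moves w to a multiple of the i0-th coordinate point, where a form
   of degree e has order > m iff no monomial has i0-degree at least e - m. *)
Lemma order_ge_translate c (w : 'I_n -> F) (e m : nat) (f : {mpoly F[n]}) :
  c i0 = 0 -> (forall j, j != i0 -> w j = c j * w i0) -> f \is e.-homog ->
  (forall mu : 'X_{1..n}, (e - m <= mu i0)%N -> (f \mPo shear c)@_mu = 0) ->
  order_ge m.+1 (f \mPo [tuple 'X_i + (w i)%:MP | i < n]).
Proof.
move=> ci0 w_eq homog_f coef0; rewrite -[f in order_ge _ (f \mPo _)](shearK f ci0).
rewrite comp_mpolyA comp_mpolyE big_seq; apply: order_ge_sum => mu mu_supp.
apply: order_geZ.
have := dhomog_mf (dhomog_comp (shear_homog c) homog_f) mu_supp.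
rewrite /= mdegE (bigD1 i0) //= => deg_mu.
have lt_mu : (mu i0 < e - m)%N.
  by rewrite ltnNge; apply: contraL mu_supp => /coef0/eqP; rewrite mcoeff_eq0.
(* For [j != i0] the [j]-th factor has constant term [w j - c j * w i0 = 0], hence order at least 1.
   The total order is thus at least [e - mu i0], which exceeds [m]. *)
suff ord_mu : order_ge (\sum_(j < n) mu j * (j != i0))%N
    (\prod_(j < n) tnth [tuple tnth (shear (fun j => - c j)) i
       \mPo [tuple 'X_i + (w i)%:MP | i < n] | i < n] j ^+ mu j).
  move=> nu lt_nu; apply: ord_mu.
  rewrite (bigD1 i0) //= eqxx muln0 add0n.
  under eq_bigr => j ne_j do rewrite ne_j muln1.
  by move: deg_mu lt_mu lt_nu; set S := (\sum_(i < n | _) _)%N; lia.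
apply: order_ge_prod => j; apply: order_geX.
have [_|ne_j] := eqVneq j i0; first exact: order_ge0.
rewrite !tnth_mktuple comp_mpolyD comp_mpolyZ !comp_mpolyXU -!tnth_nth.
rewrite !tnth_mktuple w_eq // => nu; rewrite ltnS leqn0 mdeg_eq0 => /eqP ->.
rewrite !(mcoeffD, mcoeffZ, mcoeffC, mcoeffX) eqxx.
have neq0 i : (U_(i)%MM == 0%MM :> 'X_{1..n}) = false.
  by rewrite -mdeg_eq0 mdeg1.
by rewrite !neq0 mulr1 mulr1 !add0r mulNr subrr.
Qed.

End Shear.

(** All representatives are multiples of one vector, so the ratios to a nonzero coordinate [i0] are
    common to them. Setting [c i0] to 0 instead of 1 makes [shear] fix ['X_i0]. *)
Lemma representative_ratio (F : fieldType) (n : nat) (P : proj_point F n) :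
  exists (i0 : 'I_n.+1) (c : 'I_n.+1 -> F), c i0 = 0 /\
    forall w, is_representative P w ->
      forall j, j != i0 -> w 0 j = c j * w 0 i0.
Proof.
have dimP := eqP (valP P); have v_neq0 : vpick (val P) != 0.
  by rewrite vpick0 -dimv_eq0 dimP.
have [i0 vi0] := rV0Pn _ v_neq0.
exists i0, (fun j => if j == i0 then 0 else vpick (val P) 0 j / vpick (val P) 0 i0).
split=> [|w [wP _] j ne_j]; first by rewrite eqxx.
rewrite (negbTE ne_j).
have spanP : val P = <[vpick (val P)]>%VS.
  apply/esym/eqP; rewrite eqEdim -memvE memv_pick dimP dim_vline v_neq0.
  by [].
move: wP; rewrite spanP => /vlineP [a ->]; rewrite -spanP !mxE.
by field.
Qed.

(** * Counting linear conditions *)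

Lemma nontrivial_kernel (K : fieldType) (U V : vectType K) (f : {linear U -> V}) :
  (dim V < dim U)%N -> exists2 u, u != 0 & f u = 0.
Proof.
move=> lt_dim; pose h := linfun f.
have ker_neq0 : lker h != 0%VS.
  rewrite -dimv_eq0; apply: contraTneq lt_dim => ker0.
  rewrite -leqNgt -!dimvf -(limg_ker_dim h fullv) capfv ker0.
  exact/dimvS/subvf.
exists (vpick (lker h)); first by rewrite vpick0.
by have := memv_pick (lker h); rewrite memv_ker lfunE => /eqP.
Qed.

Section CoefMap.
Context (F : fieldType) (n s t e : nat).
Context (A : 'I_s -> n.+1.-tuple {mpoly F[n.+1]}).
Context (mon : 'I_s -> 'I_t -> 'X_{1..n.+1}).

(** Row [i] collects the conditions imposed by the [i]-th point: coefficients that must vanish after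
    the change of coordinates [A i]. *)
Definition comp_coef (f : dhomog n.+1 F e) : 'M[F]_(s, t) :=
  \matrix_(i, k) (val f \mPo A i)@_(mon i k).

Lemma comp_coef_is_linear : linear comp_coef.
Proof.
move=> a f g; apply/matrixP=> i k; rewrite !mxE.
have -> : val (a *: f + g) = a *: val f + val g by [].
by rewrite comp_mpolyD comp_mpolyZ mcoeffD mcoeffZ.
Qed.

HB.instance Definition _ :=
  GRing.isLinear.Build F (dhomog n.+1 F e) 'M[F]_(s, t) _ comp_coef
    comp_coef_is_linear.

End CoefMap.

(** Forms of degree [e] have dimension C(e+n, n), and order [m.+1] at one point costs C(m+n, n)
    conditions, so the map to the conditions has a nonzero kernel. *)
Lemma exists_form (F : fieldType) (n s m e : nat) (p : 'I_s -> proj_point F n) :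
  (m <= e)%N -> (s * 'C(m + n, n) < 'C(e + n, n))%N ->
  exists f : {mpoly F[n.+1]},
    [/\ f != 0, f \is e.-homog & forall i, vanishes_to_order m.+1 f (p i)].
Proof.
move=> le_me lt_dim.
have bin_sym k : 'C(k + n, k) = 'C(k + n, n).
  by rewrite -bin_sub ?leq_addr // addKn.
have [i0 /choice [c c_spec]] := choice (fun i => representative_ratio (p i)).
(* The forbidden monomials, of degree [e] and [i0]-exponent at least [e - m], are those of degree
   [m] (listed by [b]) times the power [e - m] of the variable. *)
pose b := [seq s2m t | t : m.-tuple 'I_n.+1 <- enum (basis n.+1 m)].
pose mon i (k : 'I_('C(m + n, m))) := (nth 0 b k + U_(i0 i) *+ (e - m))%MM.
pose phi := comp_coef (fun i => shear (i0 i) (c i)) mon : dhomog n.+1 F e -> _.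
have [|f f_neq0 phi_f] := @nontrivial_kernel _ _ _ phi.
  by rewrite [X in (X < _)%N]/dim /= [X in (_ < X)%N]/dim /= !bin_sym.
exists (val f); split=> [|| i w w_rep mu]; first by [].
  exact: (valP f).
have [ci0 w_ratio] := c_spec i.
apply: (order_ge_translate ci0 (w_ratio w w_rep) (valP f)) => {}mu le_mu.
(* A coefficient in degree other than [e] vanishes by homogeneity; the remaining ones are entries of
   [phi f]. *)
set g := _ \mPo _; have [deg_mu|] := eqVneq (mdeg mu) e; last first.
  exact/dhomog_nemf_coeff/dhomog_comp/(valP f)/shear_homog.
pose nu := (mu - U_(i0 i) *+ (e - m))%MM.
have mu_eq : mu = (nu + U_(i0 i) *+ (e - m))%MM.
  rewrite submK //; apply/mnm_lepP => j; rewrite mulmnE mnm1E.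
  by case: eqP => [<-|]; rewrite ?mul1n.
have nu_b : nu \in b.
  rewrite -basis_cover; move: deg_mu; rewrite mu_eq mdegD mdegMn mdeg1; lia.
have lt_k : (index nu b < 'C(m + n, m))%N by rewrite -size_basis index_mem.
have := congr1 (fun M : 'M__ => M i (Ordinal lt_k)) phi_f.
by rewrite !mxE /mon /= nth_index // -mu_eq.
Qed.

(** * Bounds on [alpha] and the conclusion *)

Lemma symbolic_power_form (F : fieldType) (n s m : nat) (p : 'I_s -> proj_point F n)
    (f : {mpoly F[n.+1]}) (e : nat) :
  f \is e.-homog -> (forall i, vanishes_to_order m f (p i)) ->
  symbolic_power p m f.
Proof.
move=> homog_f ord_f; exists 1%N, (fun=> 1), (fun=> f); split=> [_|].
  by split=> //; exists e.
by rewrite big_ord1 mul1r.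
Qed.

Lemma alpha_le (F : fieldType) (n : nat) (J : set {mpoly F[n.+1]}) (e : nat) :
  has_form_of_degree J e -> (alpha J <= e)%N.
Proof.
(* If [xget] returns its default, the value is 0 and the bound is trivial. *)
by rewrite /alpha; case: xgetP => [d _ [_ min_d] /min_d|].
Qed.

(** Otherwise [exists_form] would give a form of degree [e], below the minimum [e.+1]. *)
Lemma alpha_symbolic_power (F : fieldType) (n s m e : nat)
    (p : 'I_s -> proj_point F n) :
  alpha (symbolic_power p m.+1) = e.+1 -> (m <= e)%N ->
  ('C(e + n, n) <= s * 'C(m + n, n))%N.
Proof.
move=> alpha_eq le_me; rewrite leqNgt; apply/negP => lt_dim.
have [f [f_neq0 homog_f ord_f]] := exists_form p le_me lt_dim.
suff : (e.+1 <= e)%N by rewrite ltnn.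
rewrite -alpha_eq; apply: alpha_le; exists f; split=> //.
exact: symbolic_power_form homog_f ord_f.
Qed.

Theorem corollary3 (R : realType) (F : closedFieldType) :
  Nagata_Iarrobino R F ->
  forall n s : nat, (1 <= n)%N -> (maxn (n + 7) (2 ^ n) <= s)%N ->
    @for_very_general F n s (fun p =>
      forall m : nat, (1 <= m)%N ->
        ((alpha (symbolic_power p m))%:R + n%:R - 1) / (m%:R + n%:R - 1)
          <= waldschmidt R p).
Proof.
move=> NI n s n_gt0 s_ge; have [Z [Z_closed NI_Z]] := NI n s n_gt0 s_ge.
(* The exceptional sets are those of the conjecture. From here on the order is [m.+1]. *)
exists Z; split=> // p p_inj pZ [//|m] _.
apply: le_trans (NI_Z p p_inj pZ); set d := alpha _.
(* As [n] is positive, the real subtraction agrees with the natural predecessor. *)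
have natE k : k%:R + n%:R - 1 = (k + n).-1%:R :> R.
  by rewrite -natrD -[in LHS](@prednK (k + n)) ?addn_gt0 ?n_gt0 ?orbT // -natr1 addrK.
rewrite !natE; apply: ratio_le_root => //.
have s_gt0 : (0 < s)%N by rewrite (leq_trans _ s_ge) // leq_max addnS.
(* Here [d] is less than the order [m.+1], so the ratio is below 1 and [s >= 1] suffices. *)
have [le_dm|] := leqP d m.
  apply: (leq_trans _ (leq_pmull _ s_gt0)).
  by rewrite leq_exp2r //; lia.
case d_eq : d => [//|e]; rewrite !addSn /= => le_me.
exact: bin_le_expn (alpha_symbolic_power d_eq le_me).
Qed.
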